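(* Let $n\ge2$. If ${\rm Comp}(\mathbb{Z}_n)\subseteq\{0,1,2,3\}$ and $p$ is an odd prime, then $n$ is not divisible by $p^3$.
   Context: $\mathbb{Z}_n$ is the cyclic group of integers modulo $n$. A skew morphism of a finite group $G$ is a permutation $\varphi$ of $G$ fixing the identity such that for each $a\in G$ there is a non-negative integer $i_a$ with $\varphi(ab)=\varphi(a)\varphi^{i_a}(b)$ for all $b\in G$. ${\rm ord}(\varphi)$ is the order of $\langle\varphi\rangle$. If $\varphi$ is non-trivial, $\pi_\varphi(a)$ is the unique such $i_a\in\{1,\dots,{\rm ord}(\varphi)-1\}$; if $\varphi$ is the identity, $\pi_\varphi(a)=1$. Let $\sigma_\varphi(x,y)=\sum_{i=0}^{x-1}\pi_\varphi(\varphi^i(y))\in\mathbb{Z}_{{\rm ord}(\varphi)}$. The derived skew morphism $\varphi'$ of a skew morphism $\varphi$ of $\mathbb{Z}_n$ is the skew morphism of $\mathbb{Z}_{{\rm ord}(\varphi)}$ given by $\varphi'(a)=\sigma_\varphi(a,1)$. Set $\varphi^{(0)}=\varphi$, $\varphi^{(i+1)}=(\varphi^{(i)})'$. For $n\ge 2$ the complexity of $\varphi$ is the unique non-negative integer $c$ such that $\varphi^{(c)}$ is a skew morphism of a non-trivial cyclic group and $\varphi^{(c+1)}$ is a skew morphism of $\mathbb{Z}_1$. ${\rm Comp}(\mathbb{Z}_n)$ denotes the set of complexities of all skew morphisms of $\mathbb{Z}_n$. *)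

(* Defs.v *)
(* MathComp (boot) world.  Z_n is modelled as {0,...,n-1} inside nat with
   addition (a + b) %% n; a map of Z_n is a function nat -> nat of which only
   the values on {0,...,n-1} matter. *)
From mathcomp Require Import all_boot.
Set Implicit Arguments. Unset Strict Implicit. Unset Printing Implicit Defensive.

Definition is_skew (n : nat) (f : nat -> nat) : Prop :=
  [/\ 0 < n,
      (forall a, a < n -> f a < n),
      (forall a b, a < n -> b < n -> f a = f b -> a = b),
      f 0 = 0
    & forall a, a < n -> exists i : nat,
        forall b, b < n -> f ((a + b) %% n) = (f a + iter i f b) %% n].

(* ord(phi): the least k >= 1 with phi^k = id on Z_n.  (A permutation of an
   n-element set has order <= n`!, so the search range is sufficient.) *)
Definition skew_ord (n : nat) (f : nat -> nat) : nat :=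
  find (fun k => (0 < k) && all (fun x => iter k f x == x) (iota 0 n))
       (iota 0 (n`!).+1).

Definition is_identity (n : nat) (f : nat -> nat) : bool :=
  all (fun x => f x == x) (iota 0 n).

Definition skew_pi (n : nat) (f : nat -> nat) (a : nat) : nat :=
  if is_identity n f then 1
  else find (fun i => (0 < i) &&
               all (fun b => f ((a + b) %% n) == (f a + iter i f b) %% n)
                   (iota 0 n))
            (iota 0 (skew_ord n f)).

Definition skew_sigma (n : nat) (f : nat -> nat) (x y : nat) : nat :=
  (\sum_(i < x) skew_pi n f (iter i f y)) %% skew_ord n f.

Definition derived (p : nat * (nat -> nat)) : nat * (nat -> nat) :=
  (skew_ord p.1 p.2, fun a => skew_sigma p.1 p.2 a (1 %% p.1)).

(* c is the complexity of phi : phi^(c) is a skew morphism of a non-trivial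
   cyclic group and phi^(c+1) is a skew morphism of Z_1. *)
Definition is_complexity (n : nat) (f : nat -> nat) (c : nat) : Prop :=
  1 < (iter c derived (n, f)).1 /\ (iter c.+1 derived (n, f)).1 = 1.

Definition Comp (n : nat) : nat -> Prop :=
  fun c => exists f, is_skew n f /\ is_complexity n f c.

(* Main.v *)
Require Import Defs.
From mathcomp Require Import all_boot all_algebra zify ring.
From Stdlib Require Import FunctionalExtensionality.
Set Implicit Arguments. Unset Strict Implicit. Unset Printing Implicit Defensive.
Import GRing.Theory.

(* Write n = p^e M with p not dividing M and e >= 3, and put a = 1 + pM. The
   geometric sum S(k) = 1 + a + ... + a^(k-1) satisfies S(k + l) = S(k) + a^k S(l),
   v_p(S(k)) = v_p(k) (p odd) and S(k) = k mod M, so S is a bijection of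
   Z_(p^(f+1) M) for every f. Transporting multiplication by -a along S gives a
   skew morphism phi of Z_(p^(f+1) M) whose order is that of -a, namely 2p^f.
   On the powers of -a its derived map psi acts as the Moebius map
   w |-> a w / (1 + (a - 1) w), of order p^f, and the derived map of psi is the
   skew morphism built from the same a on Z_(p^f). Hence phi has complexity
   2f + 1, which is at least 5 when f + 1 = e >= 3. *)

Lemma find_iota_least (P : pred nat) K m :
  m < K -> P m -> (forall k, k < m -> ~~ P k) -> find P (iota 0 K) = m.
Proof.
move=> lt_mK Pm before_m.
rewrite -(subnKC (ltnW lt_mK)) iotaD find_cat size_iota add0n.
have -> : has P (iota 0 m) = false.
  by apply/hasPn => k; rewrite mem_iota add0n => /andP[_ /before_m].
have [l ->] : exists l, K - m = l.+1 by exists (K - m).-1; rewrite prednK // subn_gt0.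
by rewrite /= Pm addn0.
Qed.

Lemma iter_ltn n (f : nat -> nat) :
  (forall x, x < n -> f x < n) -> forall k x, x < n -> iter k f x < n.
Proof. by move=> f_lt; elim=> [|k IH] x //= /IH /f_lt. Qed.

Lemma iter_eq_in n (g h : nat -> nat) :
  (forall x, x < n -> g x = h x) -> (forall x, x < n -> g x < n) ->
  forall k x, x < n -> iter k g x = iter k h x.
Proof.
move=> gh g_lt; elim=> [|k IH] x x_lt //=.
by rewrite -IH // gh // iter_ltn.
Qed.

(* The tests searched by [skew_ord] and [skew_pi]. *)
Definition iter_is_id n (f : nat -> nat) k :=
  all (fun x => iter k f x == x) (iota 0 n).

Definition skew_power n (f : nat -> nat) a i :=
  all (fun b => f ((a + b) %% n) == (f a + iter i f b) %% n) (iota 0 n).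

Lemma skew_ordE n f m : 0 < m <= n`! ->
  (forall k, iter_is_id n f k = (m %| k)) -> skew_ord n f = m.
Proof.
move=> /andP[m_gt0 le_m_fact] idE; apply: find_iota_least => [|/=|k lt_km /=].
- by rewrite ltnS.
- by rewrite m_gt0 [all _ _]idE dvdnn.
- by case: k lt_km => // k lt_km; rewrite [all _ _]idE gtnNdvd.
Qed.

Lemma skew_powerE n f a K i : (forall x, x < n -> f x < n) ->
  (forall b, b < n -> f ((a + b) %% n) = (f a + iter K f b) %% n) ->
  skew_power n f a i = all (fun b => iter K f b == iter i f b) (iota 0 n).
Proof.
move=> f_lt skewK; apply: eq_in_all => b; rewrite mem_iota => /andP[_ b_lt].
by rewrite skewK // eqn_modDl !modn_small ?(iter_ltn f_lt).
Qed.

Lemma skew_pi_mod n f m a K : 0 < m -> skew_ord n f = m ->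
  (forall k, iter_is_id n f k = (m %| k)) ->
  (forall i, skew_power n f a i = (K == i %[mod m])) ->
  skew_pi n f a = K %[mod m].
Proof.
move=> m_gt0 ordE idE powE; rewrite /skew_pi ordE.
case: ifP => [f_id | _].
  have /eqP -> : m == 1 by rewrite -dvdn1 -idE.
  by rewrite !modn1.
have [K0 | K_neq0] := eqVneq (K %% m) 0.
  rewrite hasNfind ?size_iota ?modnn ?K0 //.
  apply/hasPn => i; rewrite mem_iota add0n => /andP[_ lt_im] /=.
  by rewrite [all _ _]powE K0 modn_small //; case: i lt_im.
rewrite (@find_iota_least _ _ (K %% m)) ?modn_mod ?ltn_pmod //= ?[all _ _]powE.
- by rewrite lt0n K_neq0 modn_mod eqxx.
move=> i lt_iK; rewrite [all _ _]powE.
by rewrite [i %% m]modn_small ?(ltn_trans lt_iK) ?ltn_pmod // gtn_eqF // andbF.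
Qed.

Lemma derived_eq_in n (g h : nat -> nat) : 0 < n ->
  (forall x, x < n -> g x = h x) -> (forall x, x < n -> g x < n) ->
  derived (n, g) = derived (n, h).
Proof.
move=> n_gt0 gh g_lt; have iter_gh := iter_eq_in gh g_lt.
have ordE : skew_ord n g = skew_ord n h.
  apply: eq_find => k /=; congr andb; apply: eq_in_all => x.
  by rewrite mem_iota add0n => /andP[_ /iter_gh ->].
have piE x : x < n -> skew_pi n g x = skew_pi n h x.
  move=> x_lt; rewrite /skew_pi ordE.
  have -> : is_identity n g = is_identity n h.
    by apply: eq_in_all => y; rewrite mem_iota add0n => /andP[_ /gh ->].
  case: ifP => // _; apply: eq_find => i /=; congr andb; apply: eq_in_all => y.
  by rewrite mem_iota add0n => /andP[_ y_lt]; rewrite !gh ?iter_gh ?ltn_pmod.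
rewrite /derived /= ordE; congr pair; apply: functional_extensionality => a.
rewrite /skew_sigma ordE; congr modn; apply: eq_bigr => i _.
have one_lt : 1 %% n < n by rewrite ltn_pmod.
by have := iter_ltn g_lt i one_lt; rewrite iter_gh // => /piE.
Qed.

Lemma prim_root_of_order (R : nzRingType) n (z : R) : 0 < n ->
  (forall k, (z ^+ k == 1)%R = (n %| k)) -> (n.-primitive_root z)%R.
Proof.
move=> n_gt0 zE; have /eqP zn : (z ^+ n == 1)%R by rewrite zE.
have [m prim_m m_dvd_n] := prim_order_exists n_gt0 zn.
suff /eqP -> : n == m by [].
by rewrite eqn_dvd -zE (prim_expr_order prim_m) eqxx.
Qed.

Lemma coprime_dvd_1addM d b z : d %| b -> coprime d (1 + b * z).
Proof. by case/dvdnP=> k ->; rewrite /coprime addnC mulnAC gcdnMDl gcdn1. Qed.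

Section SkewFamily.
Variables p c : nat.
Hypotheses (p_prime : prime p) (p_odd : odd p) (p_coprime_c : coprime p c).

Lemma expn_1pt_expand t i : exists X, (1 + p * t) ^ i = 1 + i * p * t + p ^ 2 * X.
Proof.
elim: i => [|i [X IH]]; first by exists 0; rewrite expn0 mul0n muln0.
by exists (i * t * t + X + X * p * t); rewrite expnS IH; ring.
Qed.

Lemma sum_expn_1pt_expand t q :
  exists Y, \sum_(i < q) (1 + p * t) ^ i = q + p * t * 'C(q, 2) + p ^ 2 * Y.
Proof.
elim: q => [|q [Y IH]]; first by exists 0; rewrite big_ord0 bin_small ?muln0.
have [X expandX] := expn_1pt_expand t q.
by exists (Y + X); rewrite big_ord_recr /= IH expandX binS bin1; ring.
Qed.

Lemma logn_sum_expn_1pt t : logn p (\sum_(i < p) (1 + p * t) ^ i) = 1.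
Proof.
have [Y ->] := sum_expn_1pt_expand t p.
have /dvdnP[z ->] : p %| 'C(p, 2) by rewrite prime_dvd_bin ?odd_prime_gt2.
rewrite (_ : _ + _ = p * (1 + p * (t * z + Y))); last by ring.
by rewrite (lognM _ (prime_gt0 p_prime)) // logn_prime // eqxx logn_coprime
  ?coprime_dvd_1addM.
Qed.

Definition alpha := 1 + p * c.
Definition beta := p * c.
Definition geom k := \sum_(i < k) alpha ^ i.

Lemma geom0 : geom 0 = 0. Proof. exact: big_ord0. Qed.

Lemma geomS k : geom k.+1 = geom k + alpha ^ k. Proof. exact: big_ord_recr. Qed.

Lemma geom1 : geom 1 = 1. Proof. by rewrite geomS geom0. Qed.

Lemma geomD k l : geom (k + l) = geom k + alpha ^ k * geom l.
Proof.
elim: l => [|l IH]; first by rewrite geom0 addn0 muln0 addn0.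
by rewrite addnS !geomS IH mulnDr -expnD addnA.
Qed.

Lemma geomM k q : geom (k * q) = geom k * \sum_(i < q) (alpha ^ k) ^ i.
Proof.
elim: q => [|q IH]; first by rewrite muln0 big_ord0 geom0 muln0.
by rewrite mulnS addnC geomD IH big_ord_recr /= mulnDr -expnM; ring.
Qed.

Lemma expn_alpha k : alpha ^ k = 1 + beta * geom k.
Proof.
elim: k => [|k IH]; first by rewrite geom0 muln0.
by rewrite geomS expnS IH /alpha /beta; ring.
Qed.

Lemma geom_gt0 k : 0 < k -> 0 < geom k.
Proof. by case: k => // k _; rewrite geomS addn_gt0 expn_gt0 orbT. Qed.

Lemma geom_mod d k : d %| beta -> geom k = k %[mod d].
Proof.
move=> d_dvd_beta; elim: k => [|k IH]; first by rewrite geom0.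
by rewrite geomS expn_alpha addnA -modnDmr (eqP (dvdn_mulr _ d_dvd_beta)) addn0
  -modnDml IH modnDml addn1.
Qed.

Lemma logn_geom k : 0 < k -> logn p (geom k) = logn p k.
Proof.
elim: k {-2}k (leqnn k) => [|K IH] k le_kK k_gt0; first by case: k le_kK k_gt0.
have [/dvdnP[k1 def_k] | p_ndvd_k] := boolP (p %| k); last first.
  rewrite !logn_coprime // prime_coprime //.
  by rewrite /dvdn geom_mod ?dvdn_mulr // -/(dvdn p k).
have k1_gt0 : 0 < k1 by move: k_gt0; rewrite def_k muln_gt0 => /andP[].
have p_gt1 := prime_gt1 p_prime.
have sum_gt0 : 0 < \sum_(i < p) (alpha ^ k1) ^ i.
  by rewrite -(prednK (prime_gt0 p_prime)) big_ord_recl expn0 addSn.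
rewrite def_k geomM lognM ?geom_gt0 // IH //; last by nia.
by rewrite expn_alpha /beta -mulnA logn_sum_expn_1pt (lognM _ k1_gt0 (prime_gt0 p_prime))
  (logn_prime _ p_prime) eqxx.
Qed.

Definition geom_log N v := find (fun k => geom k == v %[mod N]) (iota 0 N).

(* Multiplication by -alpha (written N.-1 * alpha) transported along geom. *)
Definition phi N i := geom_log N (N.-1 * alpha * geom i).

Section Modulus.
Variables f M : nat.
Hypothesis M_dvd_c : M %| c.
Local Notation N := (p ^ f * M).

Lemma modulus_gt0 : 0 < N.
Proof.
rewrite muln_gt0 expn_gt0 prime_gt0 //=; apply: dvdn_gt0 M_dvd_c; rewrite lt0n.
by apply: contraTneq p_coprime_c => ->; rewrite /coprime gcdn0 gtn_eqF ?prime_gt1.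
Qed.

Lemma dvdn_geom k : (N %| geom k) = (N %| k).
Proof.
have M_coprime_p : coprime p M := coprime_dvdr M_dvd_c p_coprime_c.
rewrite !Gauss_dvd ?coprimeXl //; congr andb.
  case: k => [|k]; first by rewrite geom0.
  by rewrite !pfactor_dvdn ?geom_gt0 ?logn_geom.
by rewrite /dvdn geom_mod // dvdn_mull.
Qed.

Lemma coprime_1beta z : coprime N (1 + beta * z).
Proof.
have p_dvd_beta : p %| beta := dvdn_mulr c (dvdnn p).
have M_dvd_beta : M %| beta := dvdn_mull p M_dvd_c.
by rewrite coprimeMl coprimeXl ?coprime_dvd_1addM.
Qed.

Lemma geom_inj i j : i < N -> j < N -> geom i = geom j %[mod N] -> i = j.
Proof.
wlog le_ij : i j / i <= j.
  move=> wlog_ij i_lt j_lt eq_ij; case: (leqP i j) => [le_ij | /ltnW le_ji].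
    exact: wlog_ij.
  by symmetry; apply: wlog_ij.
move=> _ j_lt; rewrite -(subnKC le_ij) geomD -{1}[geom i]addn0 => /eqP.
rewrite eqn_modDl eq_sym mod0n -/(dvdn _ _) Gauss_dvdr; last first.
  by rewrite expn_alpha coprime_1beta.
rewrite dvdn_geom; case: (j - i) (leq_subr i j) => [_ _ | d le_dj N_dvd_d].
  by rewrite addn0.
by have := dvdn_leq (ltn0Sn d) N_dvd_d; rewrite leqNgt (leq_ltn_trans le_dj j_lt).
Qed.

Lemma geom_logP v : geom_log N v < N /\ geom (geom_log N v) = v %[mod N].
Proof.
pose geom_mod_N (k : 'I_N) : 'I_N := Ordinal (ltn_pmod (geom k) modulus_gt0).
have /injF_bij[geom_mod_N_inv _ geom_mod_N_invK] : injective geom_mod_N.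
  by move=> k l /(congr1 val) /= /geom_inj eq_kl; apply/val_inj/eq_kl.
have has_log : has (fun k => geom k == v %[mod N]) (iota 0 N).
  set w := Ordinal (ltn_pmod v modulus_gt0).
  apply/hasP; exists (nat_of_ord (geom_mod_N_inv w)); first by rewrite mem_iota /=.
  by have /(congr1 val) /= -> := geom_mod_N_invK w.
have log_lt : geom_log N v < N by move: has_log; rewrite has_find size_iota.
split=> //; have /eqP := nth_find 0 has_log.
by rewrite nth_iota // add0n; apply.
Qed.

End Modulus.

Section Level.
Variables f M : nat.
Hypothesis M_dvd_c : M %| c.
Local Notation N := (p ^ f.+1 * M).

Lemma modulus_gt1 : 1 < N.
Proof.
rewrite expnS -mulnA (leq_trans (prime_gt1 p_prime)) // leq_pmulr //.
exact: modulus_gt0 M_dvd_c.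
Qed.

Lemma ord_phi_gt1 : 1 < 2 * p ^ f.
Proof. by rewrite (leq_trans (isT : 1 < 2)) // leq_pmulr // expn_gt0 prime_gt0. Qed.

Lemma ord_phi_le_modulus : 2 * p ^ f <= N.
Proof.
rewrite expnS -mulnA leq_mul ?prime_gt1 // leq_pmulr //.
by have := modulus_gt0 0 M_dvd_c; rewrite mul1n.
Qed.

Lemma phi_lt i : phi N i < N.
Proof. by case: (geom_logP f.+1 M_dvd_c (N.-1 * alpha * geom i)). Qed.

Lemma iter_phi_lt j i : i < N -> iter j (phi N) i < N.
Proof. exact: iter_ltn (fun x _ => phi_lt x) j i. Qed.

Local Open Scope ring_scope.
Local Notation R := 'Z_N.
Local Notation A := (alpha%:R : R).
Local Notation B := (beta%:R : R).
Local Notation U := (- A).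
Local Notation S k := ((geom k)%:R : R).

Lemma eq_natZ x y : ((x%:R : R) == y%:R) = (x == y %[mod N])%N.
Proof. by rewrite -val_eqE /= !val_Zp_nat // modulus_gt1. Qed.

Lemma natZ_eq0 x : ((x%:R : R) == 0) = (N %| x)%N.
Proof. by rewrite -val_eqE /= val_Zp_nat // modulus_gt1. Qed.

Lemma natr_pred_mul_alpha : ((N.-1 * alpha)%:R : R) = U.
Proof.
rewrite natrM; have -> : (N.-1)%:R = -1 :> R.
  apply/eqP; rewrite -subr_eq0 opprK natr1 prednK ?(ltnW modulus_gt1) //.
  by rewrite pchar_Zp // modulus_gt1.
exact: mulN1r.
Qed.

Lemma alpha_1B : A = 1 + B. Proof. by rewrite natrD. Qed.

Lemma expr_alpha k : A ^+ k = 1 + B * S k.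
Proof. by rewrite -natrX expn_alpha natrD natrM. Qed.

Lemma geomr1 : S 1 = 1. Proof. by rewrite geom1. Qed.

Lemma geomrD k l : S (k + l) = S k + A ^+ k * S l.
Proof. by rewrite geomD natrD natrM natrX. Qed.

Lemma geomrS k : S k.+1 = S k + A ^+ k.
Proof. by rewrite geomS natrD natrX. Qed.

Lemma geomr_eq0 k : (N %| k)%N -> S k = 0.
Proof. by move=> N_dvd_k; apply/eqP; rewrite natZ_eq0 dvdn_geom. Qed.

Lemma expr_alphaN : A ^+ N = 1.
Proof. by rewrite expr_alpha geomr_eq0 // mulr0 addr0. Qed.

Lemma geomr_mod k : S (k %% N) = S k.
Proof.
have S_eq0 : S (k %/ N * N) = 0 by apply/geomr_eq0/dvdn_mull.
by rewrite {2}(divn_eq k N) geomrD S_eq0 expr_alpha S_eq0 mulr0 addr0 mul1r add0r.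
Qed.

Lemma unit_1B (z : R) : 1 + B * z \is a GRing.unit.
Proof.
rewrite -(natr_Zp z) -natrM nat1r -[(_ * _).+1]add1n unitZpE ?modulus_gt1 //.
exact: coprime_1beta.
Qed.

Lemma unit_alpha : A \is a GRing.unit.
Proof. by rewrite alpha_1B -[B]mulr1 unit_1B. Qed.

Lemma unit_U : U \is a GRing.unit.
Proof. by rewrite unitrN unit_alpha. Qed.

Lemma mulB_natr_eq0 x : (B * x%:R == 0) = (p ^ f %| x)%N.
Proof.
have M_coprime_p : coprime p M := coprime_dvdr M_dvd_c p_coprime_c.
rewrite -natrM natZ_eq0 /beta expnS -!mulnA dvdn_pmul2l ?prime_gt0 //.
by rewrite Gauss_dvd ?coprimeXl // (dvdn_mulr _ M_dvd_c) andbT Gauss_dvdr // coprimeXl.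
Qed.

Lemma mulB_1A_eq0 (Y : R) : B * Y * (1 + A) = 0 -> B * Y = 0.
Proof.
have p_coprime_1alpha : coprime p (1 + alpha).
  by rewrite /alpha addnA addnC mulnC /coprime gcdnMDl -/(coprime p 2) coprimen2.
move=> BY1A; have : B * (Y * (1 + alpha))%:R == 0.
  by rewrite natrM natrD mulr1n natr_Zp mulrA BY1A.
rewrite mulB_natr_eq0 Gauss_dvdl ?coprimeXl // => p_dvd_Y.
by apply/eqP; rewrite -(natr_Zp Y) mulB_natr_eq0.
Qed.

Lemma prim_alpha : (p ^ f).-primitive_root A.
Proof.
apply: prim_root_of_order => [|k]; first by rewrite expn_gt0 prime_gt0.
rewrite expr_alpha -[X in _ == X](addr0 1) (inj_eq (addrI 1)) mulB_natr_eq0.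
by rewrite -[(p ^ f)%N]muln1 dvdn_geom ?dvd1n.
Qed.

Lemma prim_U : (2 * p ^ f).-primitive_root U.
Proof.
apply: prim_root_of_order => [|k]; first exact: ltnW ord_phi_gt1.
rewrite exprNn -signr_odd Gauss_dvd ?coprimeXr ?coprime2n // dvdn2.
case: (boolP (odd k)) => [k_odd | k_even]; last first.
  by rewrite expr0 mul1r -(prim_order_dvd prim_alpha).
rewrite expr1 mulN1r /=; apply/negP => /eqP A_k_opp.
have : ((2 + beta * geom k)%:R : R) == 0.
  have -> : ((2 + beta * geom k)%:R : R) = 1 + A ^+ k by rewrite expr_alpha natrD natrM; ring.
  by rewrite -[X in X + _]A_k_opp addNr.
rewrite natZ_eq0 => /(dvdn_trans (dvdn_mulr M (dvdn_exp2l p (ltn0Sn f)))).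
rewrite expn1 dvdn_addl /beta -?mulnA ?dvdn_mulr // => /(dvdn_leq (ltn0Sn 1)).
by rewrite leqNgt odd_prime_gt2.
Qed.

Lemma expr_U_1pf : U ^+ (1 + p ^ f) = A.
Proof.
rewrite add1n exprS exprNn (prim_expr_order prim_alpha) mulr1 -signr_odd oddX p_odd orbT.
by rewrite expr1 mulrN1 opprK.
Qed.

Lemma geomr_phi i : S (phi N i) = U * S i.
Proof.
have [_ /eqP] := geom_logP f.+1 M_dvd_c (N.-1 * alpha * geom i).
by rewrite -eq_natZ natrM natr_pred_mul_alpha => /eqP.
Qed.

Lemma geomr_iter_phi j i : S (iter j (phi N) i) = U ^+ j * S i.
Proof.
elim: j => [|j IH] /=; first by rewrite mul1r.
by rewrite geomr_phi IH exprS mulrA.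
Qed.

Lemma geomr_inj i j : (i < N)%N -> (j < N)%N -> S i = S j -> i = j.
Proof. by move=> i_lt j_lt /eqP; rewrite eq_natZ => /eqP /(geom_inj M_dvd_c i_lt j_lt). Qed.

Lemma iter_phi_eqE i k :
  all (fun b => iter i (phi N) b == iter k (phi N) b) (iota 0 N) = (U ^+ i == U ^+ k).
Proof.
apply/allP/eqP => [/(_ 1%N) | U_ik b].
  rewrite mem_iota add0n modulus_gt1 => /(_ isT) /eqP /(congr1 (fun x => S x)).
  by rewrite !geomr_iter_phi geomr1 !mulr1.
rewrite mem_iota add0n => /andP[_ b_lt]; apply/eqP/geomr_inj; rewrite ?iter_phi_lt //.
by rewrite !geomr_iter_phi U_ik.
Qed.

Lemma iter_is_id_phi k : iter_is_id N (phi N) k = (2 * p ^ f %| k)%N.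
Proof. by rewrite (prim_order_dvd prim_U); have := iter_phi_eqE k 0; rewrite expr0. Qed.

Lemma skew_ord_phi : skew_ord N (phi N) = (2 * p ^ f)%N.
Proof.
apply: skew_ordE iter_is_id_phi.
by rewrite (ltnW ord_phi_gt1) (leq_trans ord_phi_le_modulus) ?fact_geq.
Qed.

(* phi (x + b) = phi x + phi^i b amounts to U^(i-1) = A^(x - phi x), and U^(1+p^f) = A. *)
Definition phi_power x := (1 + (1 + p ^ f) * (x + (N - phi N x)))%N.

Lemma expr_U_phi_power x : U ^+ phi_power x = U * A ^+ (x + (N - phi N x)).
Proof. by rewrite /phi_power exprD expr1 exprM expr_U_1pf. Qed.

Lemma expr_alpha_phi_shift x : A ^+ phi N x * A ^+ (x + (N - phi N x)) = A ^+ x.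
Proof. by rewrite -exprD addnCA subnKC ?(ltnW (phi_lt x)) // exprD expr_alphaN mulr1. Qed.

Lemma phi_skew x : (x < N)%N -> forall b, (b < N)%N ->
  (phi N ((x + b) %% N) = (phi N x + iter (phi_power x) (phi N) b) %% N)%N.
Proof.
move=> x_lt b b_lt; apply: geomr_inj; rewrite ?phi_lt ?ltn_pmod ?(modulus_gt0 _ M_dvd_c) //.
rewrite geomr_phi !geomr_mod !geomrD geomr_phi geomr_iter_phi expr_U_phi_power.
by rewrite -(expr_alpha_phi_shift x); ring.
Qed.

Lemma phi_is_skew : Defs.is_skew N (phi N).
Proof.
split=> [|x _|x y x_lt y_lt eq_phi|| x x_lt]; first exact: modulus_gt0 M_dvd_c.
- exact: phi_lt.
- apply: geomr_inj => //; apply: (mulrI unit_U).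
  by rewrite -!geomr_phi eq_phi.
- by apply: geomr_inj; rewrite ?phi_lt ?(modulus_gt0 _ M_dvd_c) // geomr_phi geom0 mulr0.
- by exists (phi_power x); exact: phi_skew.
Qed.

Lemma skew_power_phi x : (x < N)%N -> forall i,
  skew_power N (phi N) x i = (phi_power x == i %[mod 2 * p ^ f])%N.
Proof.
move=> x_lt i; rewrite (skew_powerE i (fun y _ => phi_lt y) (phi_skew x_lt)).
by rewrite iter_phi_eqE (eq_prim_root_expr prim_U).
Qed.

Lemma skew_pi_phi x : (x < N)%N ->
  (skew_pi N (phi N) x = phi_power x %[mod 2 * p ^ f])%N.
Proof.
move=> x_lt; apply: (skew_pi_mod _ skew_ord_phi iter_is_id_phi (skew_power_phi x_lt)).
exact: ltnW ord_phi_gt1.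
Qed.

Definition psi j := skew_sigma N (phi N) j (1 %% N).

Lemma psi_lt j : (psi j < 2 * p ^ f)%N.
Proof. by rewrite /psi /skew_sigma skew_ord_phi ltn_pmod // ltnW ?ord_phi_gt1. Qed.

Lemma iter_psi_lt l j : (j < 2 * p ^ f)%N -> (iter l psi j < 2 * p ^ f)%N.
Proof. exact: iter_ltn (fun x _ => psi_lt x) l j. Qed.

Lemma expr_alpha_iter_phi1 j : A ^+ iter j (phi N) 1 = 1 + B * U ^+ j.
Proof. by rewrite expr_alpha geomr_iter_phi geomr1 mulr1. Qed.

Lemma expr_U_sum_pi j :
  U ^+ (\sum_(i < j) skew_pi N (phi N) (iter i (phi N) 1)) * A ^+ iter j (phi N) 1
  = U ^+ j * A.
Proof.
elim: j => [|j IH]; first by rewrite big_ord0 !expr0 mul1r expr1.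
rewrite big_ord_recr /= exprD; set s := \sum_(i < j) _; set y := iter j (phi N) 1.
have y_lt : (y < N)%N by rewrite iter_phi_lt ?modulus_gt1.
rewrite -[U ^+ skew_pi _ _ y](prim_expr_mod prim_U) skew_pi_phi // (prim_expr_mod prim_U).
rewrite expr_U_phi_power exprS -[RHS]mulrA -IH -(expr_alpha_phi_shift y).
(* [ring] would try to evaluate the exponents, which unfold to [skew_ord]. *)
by move: (U ^+ s) (A ^+ phi N y) (A ^+ (y + _)) => u a1 a2; ring.
Qed.

Lemma psi_moebius j : U ^+ psi j * (1 + B * U ^+ j) = A * U ^+ j.
Proof.
rewrite /psi /skew_sigma skew_ord_phi (prim_expr_mod prim_U) modn_small ?modulus_gt1 //.
by rewrite -expr_alpha_iter_phi1 expr_U_sum_pi mulrC.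
Qed.

Lemma U_inj i j : (i < 2 * p ^ f)%N -> (j < 2 * p ^ f)%N -> U ^+ i = U ^+ j -> i = j.
Proof.
by move=> i_lt j_lt /eqP; rewrite (eq_prim_root_expr prim_U) !modn_small // => /eqP.
Qed.

Lemma psi_iter l j : U ^+ iter l psi j * (1 + B * S l * U ^+ j) = A ^+ l * U ^+ j.
Proof.
elim: l => [|l IH]; first by rewrite /= geom0 !mulr0 mul0r addr0 mulr1 expr0 mul1r.
rewrite iterS; set J := iter l psi j; set D := 1 + B * S l * U ^+ j.
have -> : 1 + B * S l.+1 * U ^+ j = (1 + B * U ^+ J) * D.
  transitivity (D + B * (A ^+ l * U ^+ j)); first by rewrite geomrS /D; ring.
  by rewrite -IH /D; move: (U ^+ J) => X; ring.
by rewrite mulrA psi_moebius -mulrA IH exprS mulrA.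
Qed.

Lemma expr_alpha_iter_psi1 i k : iter i psi 1 = iter k psi 1 -> A ^+ i = A ^+ k.
Proof.
move=> eq_ik; have := psi_iter i 1; have := psi_iter k 1.
rewrite -eq_ik !expr1 !expr_alpha; move: (U ^+ _) => Z eq_k eq_i.
have : U * (B * (S i - S k) * (1 + A)) = U * 0.
  rewrite mulr0; transitivity
    ((1 + B * S i) * U * (1 + B * S k * U) - (1 + B * S k) * U * (1 + B * S i * U)).
    by ring.
  by rewrite -eq_i -eq_k; ring.
move/(mulrI unit_U)/mulB_1A_eq0/eqP; rewrite mulrBr subr_eq0 => /eqP eq_BS.
by rewrite eq_BS.
Qed.

Lemma iter_psi_eq i k b : (b < 2 * p ^ f)%N -> A ^+ i = A ^+ k ->
  iter i psi b = iter k psi b.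
Proof.
move=> b_lt eq_ik; apply: U_inj; rewrite ?iter_psi_lt //.
have eq_BS : B * S i = B * S k by move: eq_ik; rewrite !expr_alpha => /addrI.
have eq_i := psi_iter i b; have eq_k := psi_iter k b.
rewrite eq_BS eq_ik -eq_k in eq_i.
by apply: (mulIr (unit_1B (S k * U ^+ b))); rewrite !mulrA.
Qed.

Lemma iter_psi_eqE i k :
  all (fun b => iter i psi b == iter k psi b) (iota 0 (2 * p ^ f)) = (A ^+ i == A ^+ k).
Proof.
apply/allP/eqP => [/(_ 1%N) | eq_ik b].
  by rewrite mem_iota add0n ord_phi_gt1 => /(_ isT) /eqP /expr_alpha_iter_psi1.
by rewrite mem_iota add0n => /andP[_ b_lt]; apply/eqP/iter_psi_eq.
Qed.

Lemma iter_is_id_psi k : iter_is_id (2 * p ^ f) psi k = (p ^ f %| k)%N.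
Proof. by rewrite (prim_order_dvd prim_alpha); have := iter_psi_eqE k 0; rewrite expr0. Qed.

Lemma skew_ord_psi : skew_ord (2 * p ^ f) psi = (p ^ f)%N.
Proof.
apply: skew_ordE iter_is_id_psi.
by rewrite expn_gt0 prime_gt0 // (leq_trans (leq_pmull _ _) (fact_geq _)).
Qed.

Lemma psi_skew j : (j < 2 * p ^ f)%N -> forall l, (l < 2 * p ^ f)%N ->
  (psi ((j + l) %% (2 * p ^ f)) = (psi j + iter (iter j (phi N) 1) psi l) %% (2 * p ^ f))%N.
Proof.
move=> j_lt l l_lt; apply: U_inj; rewrite ?psi_lt ?ltn_pmod ?(ltnW ord_phi_gt1) //.
rewrite (prim_expr_mod prim_U) exprD; apply: (mulIr (unit_1B (U ^+ (j + l)))).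
have moebius_jl := psi_moebius ((j + l) %% (2 * p ^ f)).
rewrite (prim_expr_mod prim_U) in moebius_jl.
have iter_l := psi_iter (iter j (phi N) 1) l.
rewrite geomr_iter_phi geomr1 mulr1 expr_alpha_iter_phi1 -mulrA -exprD in iter_l.
by rewrite moebius_jl -mulrA iter_l mulrA psi_moebius -mulrA -exprD.
Qed.

Lemma skew_power_psi j : (j < 2 * p ^ f)%N -> forall i,
  skew_power (2 * p ^ f) psi j i = (iter j (phi N) 1 == i %[mod p ^ f])%N.
Proof.
move=> j_lt i; rewrite (skew_powerE i (fun x _ => psi_lt x) (psi_skew j_lt)).
by rewrite iter_psi_eqE (eq_prim_root_expr prim_alpha).
Qed.

Lemma skew_pi_psi j : (j < 2 * p ^ f)%N ->
  (skew_pi (2 * p ^ f) psi j = iter j (phi N) 1 %[mod p ^ f])%N.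
Proof.
move=> j_lt; apply: (skew_pi_mod _ skew_ord_psi iter_is_id_psi (skew_power_psi j_lt)).
by rewrite expn_gt0 prime_gt0.
Qed.

Definition psi2 i := skew_sigma (2 * p ^ f) psi i (1 %% (2 * p ^ f)).

Lemma psi2_lt i : (psi2 i < p ^ f)%N.
Proof. by rewrite /psi2 /skew_sigma skew_ord_psi ltn_pmod // expn_gt0 prime_gt0. Qed.

Lemma expr_alpha_psi2 i : A ^+ psi2 i = 1 + B * S i * U.
Proof.
rewrite /psi2 /skew_sigma skew_ord_psi (prim_expr_mod prim_alpha) modn_small ?ord_phi_gt1 //.
elim: i => [|i IH]; first by rewrite big_ord0 expr0 geom0 !mulr0 mul0r addr0.
rewrite big_ord_recr /= exprD IH; set y := iter i psi 1.
have y_lt : (y < 2 * p ^ f)%N by rewrite iter_psi_lt ?ord_phi_gt1.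
rewrite -[A ^+ skew_pi _ _ y](prim_expr_mod prim_alpha) skew_pi_psi //.
rewrite (prim_expr_mod prim_alpha) expr_alpha_iter_phi1 geomrS.
have := psi_iter i 1; rewrite expr1 -/y; move: (U ^+ y) => Z eq_Z.
transitivity ((1 + B * S i * U) + B * (Z * (1 + B * S i * U))); first by ring.
by rewrite eq_Z; ring.
Qed.

Lemma mulB_natr_inj x y : B * x%:R = B * y%:R -> (x = y %[mod p ^ f])%N.
Proof.
wlog le_yx : x y / (y <= x)%N.
  move=> wlog_xy eq_xy; case: (leqP y x) => [le_yx | /ltnW le_xy].
    exact: wlog_xy.
  by symmetry; apply: wlog_xy.
move=> /eqP; rewrite -subr_eq0 -mulrBr -natrB // mulB_natr_eq0 => dvd_xy.
by apply/eqP; rewrite eqn_mod_dvd.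
Qed.

Lemma psi2_phi i : (i < p ^ f)%N -> psi2 i = phi (p ^ f * 1) i.
Proof.
move=> i_lt; have := geom_logP f (dvd1n c) ((p ^ f * 1).-1 * alpha * geom i).
rewrite muln1 => -[phi_lt1 geom_phi1].
apply: (@geom_inj f 1 (dvd1n c)); rewrite ?muln1 ?psi2_lt // /phi geom_phi1.
have eq_B : B * S (psi2 i) = B * (geom i * (N.-1 * alpha))%:R.
  by apply: (addrI 1); rewrite -expr_alpha expr_alpha_psi2 natrM natr_pred_mul_alpha mulrA.
rewrite (mulB_natr_inj eq_B).
have pred_mod : (N.-1 = (p ^ f).-1 %[mod p ^ f])%N.
  have pf_gt0 : (0 < p ^ f)%N by rewrite expn_gt0 prime_gt0.
  apply/eqP; rewrite -(eqn_modDr 1) !addn1 !prednK ?(ltnW modulus_gt1) //.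
  by rewrite modnn expnS mulnAC modnMl.
by rewrite mulnC -!mulnA -modnMml pred_mod modnMml.
Qed.

End Level.

Definition skew_family f M := (p ^ f * M, phi (p ^ f * M)).

Lemma derived_family f M : M %| c -> derived (skew_family f.+1 M) = (2 * p ^ f, psi f M).
Proof. by move=> M_dvd_c; rewrite /derived /= skew_ord_phi. Qed.

Lemma derived_psi f M : M %| c -> derived (2 * p ^ f, psi f M) = (p ^ f, psi2 f M).
Proof. by move=> M_dvd_c; rewrite /derived /= skew_ord_psi. Qed.

Lemma derived_psi2 f M : M %| c ->
  derived (p ^ f, psi2 f M) = derived (skew_family f 1).
Proof.
move=> M_dvd_c; rewrite /skew_family muln1; apply: derived_eq_in => [|x x_lt|x _].
- by rewrite expn_gt0 prime_gt0.
- by rewrite psi2_phi // muln1.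
- exact: psi2_lt.
Qed.

Lemma family_complexity f M : M %| c ->
  is_complexity (p ^ f.+1 * M) (phi (p ^ f.+1 * M)) f.*2.+1.
Proof.
elim: f M => [|f IH] M M_dvd_c; rewrite /is_complexity -/(skew_family _ M).
  change (1 < (derived (skew_family 1 M)).1 /\ (derived (derived (skew_family 1 M))).1 = 1).
  by rewrite derived_family // derived_psi //= expn0 muln1.
have [IH1 IH2] := IH 1 (dvd1n c); rewrite -/(skew_family f.+1 1) in IH1 IH2.
have iter3E k : iter (k + 3) derived (skew_family f.+2 M)
                = iter k.+1 derived (skew_family f.+1 1).
  rewrite iterD [RHS]iterSr; congr iter.
  change (derived (derived (derived (skew_family f.+2 M))) = derived (skew_family f.+1 1)).
  by rewrite derived_family // derived_psi // derived_psi2.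
by rewrite doubleS -(addn3 f.*2.+1) -(addn3 f.*2) !iter3E.
Qed.

End SkewFamily.

Theorem corollary6p4 (n p : nat) :
  2 <= n ->
  (forall c, Comp n c -> c <= 3) ->
  prime p -> odd p ->
  ~~ (p ^ 3 %| n).
Proof.
move=> n_ge2 comp_le3 p_prime p_odd; apply/negP => p3_dvd_n.
have [M p_coprime_M def_n] := pfactor_coprime p_prime (ltnW n_ge2).
have : 2 < logn p n by rewrite -pfactor_dvdn // ltnW.
move: def_n; case: (logn p n) => [|e] // def_n e_gt1.
have : Comp n e.*2.+1.
  rewrite def_n mulnC; exists (phi p M (p ^ e.+1 * M)); split.
    exact: (phi_is_skew p_prime p_odd p_coprime_M e (dvdnn M)).
  exact: (family_complexity p_prime p_odd p_coprime_M e (dvdnn M)).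
by move/comp_le3; rewrite -addnn; lia.
Qed.
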